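(* Let $\mathcal G$ be a temporal graph, let $(\star)$ be one of the optimality criteria shortest, shortest-foremost, prefix-foremost, and suppose that the $(\star)$-temporal vertex diameter satisfies $VD^{(\star)}\ge 3$. Then the VC-dimension of the range space $\mathcal R=(\mathcal D,\mathcal F^+)$ defined in the context satisfies $$VC(\mathcal R)\le\lfloor\log_2(VD^{(\star)}-2)\rfloor+1 .$$
   Context: A (directed) temporal graph is $\mathcal G=(V,\mathcal E)$ with $V$ finite and $\mathcal E$ a finite set of temporal edges $(u,v,t)$, $u,v\in V$, $t\in T=\{1,\dots,|T|\}$. A temporal path from $s$ to $z\ne s$ is a sequence of vertex appearances $((u_1,t_1),\dots,(u_k,t_k))$ with $u_1=s$, $u_k=z$, $t_1=0$, $t_i<t_{i+1}$ and $(u_i,u_{i+1},t_{i+1})\in\mathcal E$. Its length is its number $k-1$ of temporal edges, its arrival time is $t_k$, and $\mathbf{Int}(tp)$ is the set of its appearances other than the first and the last. It is foremost if no temporal path from $s$ to $z$ arrives earlier (the trivial path from $s$ to itself arrives at time $0$). $(\star)$-optimal means: shortest (minimum length), shortest-foremost (minimum length among foremost paths), or prefix-foremost (foremost with every prefix foremost). Let $\mathcal U=\mathbb{TP}^{(\star)}_{\mathcal G}$ be the set of all $(\star)$-optimal temporal paths between all ordered pairs of distinct nodes. The $(\star)$-temporal diameter $D^{(\star)}$ is the maximum length of a path in $\mathcal U$, and the $(\star)$-temporal vertex diameter is $VD^{(\star)}=D^{(\star)}+1$. Range space: $\mathcal D=\mathcal U\times[0,1]$. For $(v,t)\in V\times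 T$ let $f_{(v,t)}:\mathcal U\to\{0,1\}$, $f_{(v,t)}(tp)=1$ if $(v,t)\in\mathbf{Int}(tp)$ and $0$ otherwise, and $R_{f_{(v,t)}}=\{(tp,\alpha)\in\mathcal D:\alpha\le f_{(v,t)}(tp)\}$. Then $\mathcal F^+=\{R_{f_{(v,t)}}:(v,t)\in V\times T\}$. The VC-dimension of $\mathcal R=(\mathcal D,\mathcal F^+)$ is the maximum size of a finite $S\subseteq\mathcal D$ that is shattered, i.e. with $\{S\cap R:R\in\mathcal F^+\}=2^S$. *)

(* Defs.v *)
From HB Require Import structures.
From mathcomp Require Import all_boot all_order all_algebra finmap.
From mathcomp Require Import all_classical all_reals all_analysis.

Set Implicit Arguments.
Unset Strict Implicit.
Unset Printing Implicit Defensive.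

Import Order.TTheory GRing.Theory Num.Theory.

Local Open Scope classical_set_scope.

(* The set of time steps is T = {1, ..., lifetime}. *)
Record tgraph := TGraph {
  vertex : finType;
  lifetime : nat;
  tedges : {fset vertex * vertex * nat};
  tedges_time : forall u v t, (u, v, t) \in tedges -> 1 <= t <= lifetime }.

Section TemporalPaths.
Variable G : tgraph.

(* Vertex appearances; time 0 is only used for the start of a path. *)
Definition appearance : choiceType := (vertex G * nat)%type.

Definition tstep (x y : appearance) : bool :=
  (x.2 < y.2) && ((x.1, y.1, y.2) \in tedges G).

(* The case s = z is allowed, so that the trivial path [:: (s, 0)] competes
   with the nontrivial prefixes of a path that return to s. *)
Definition tpath (s z : vertex G) (p : seq appearance) : bool :=
  if p is x :: q then
    [&& x == (s, 0), path tstep x q & (last x q).1 == z]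
  else false.

Definition tlength (p : seq appearance) : nat := (size p).-1.

Definition arrival (p : seq appearance) : nat := last 0 [seq x.2 | x <- p].

Definition Int (p : seq appearance) : seq appearance :=
  if p is x :: q then behead (belast x q) else [::].

Definition foremost (s z : vertex G) (p : seq appearance) : Prop :=
  tpath s z p /\ forall q, tpath s z q -> arrival p <= arrival q.

Definition shortest (s z : vertex G) (p : seq appearance) : Prop :=
  tpath s z p /\ forall q, tpath s z q -> tlength p <= tlength q.

Definition shortest_foremost (s z : vertex G) (p : seq appearance) : Prop :=
  foremost s z p /\ forall q, foremost s z q -> tlength p <= tlength q.

Definition prefix_foremost (s z : vertex G) (p : seq appearance) : Prop :=
  foremost s z p /\
  forall x q, prefix (x :: q) p -> foremost s (last x q).1 (x :: q).

End TemporalPaths.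

Inductive criterion := Shortest | ShortestForemost | PrefixForemost.

Section Optimal.
Variables (G : tgraph) (star : criterion).

Definition optimal : vertex G -> vertex G -> seq (appearance G) -> Prop :=
  match star with
  | Shortest => @shortest G
  | ShortestForemost => @shortest_foremost G
  | PrefixForemost => @prefix_foremost G
  end.

Definition optimal_paths : set (seq (appearance G)) :=
  [set p | exists s z, s != z /\ optimal s z p].

(* Times increase strictly within {0, ..., lifetime}, so every length is at
   most the lifetime; see [tdiam_ub] and [tdiam_attained]. *)
Definition tdiam : nat :=
  \max_(n < (lifetime G).+1 |
        `[< exists2 p, optimal_paths p & tlength p = n >]) n.

Definition vdiam : nat := tdiam.+1.

End Optimal.

Lemma optimal_tpath (G : tgraph) star s z (p : seq (appearance G)) :
  optimal star s z p -> tpath s z p.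
Proof. by case: star => [[]|[[]]|[[]]]. Qed.

Lemma tlength_lifetime (G : tgraph) s z (p : seq (appearance G)) :
  tpath s z p -> tlength p <= lifetime G.
Proof.
case: p => [//|x q] /and3P[/eqP -> + _]; rewrite /tlength /=.
have H : forall (q : seq (appearance G)) (y : appearance G),
    y.2 <= lifetime G -> path (@tstep G) y q -> size q + y.2 <= lifetime G.
  elim=> [//|a r IH] y yl /= /andP[/andP[ya /tedges_time /andP[_ al]] /IH].
  move=> /(_ al) h; rewrite addSn -addnS; apply: leq_trans h.
  by rewrite leq_add2l.
by move=> /H; rewrite addn0; apply.
Qed.

Lemma tdiam_ub (G : tgraph) star (p : seq (appearance G)) :
  optimal_paths star p -> tlength p <= tdiam G star.
Proof.
move=> Up; have [s [z [_ /optimal_tpath/tlength_lifetime le_p]]] := Up.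
by apply: (leq_bigmax_cond (Ordinal (le_p : tlength p < _.+1)));
  apply/asboolP; exists p.
Qed.

Lemma tdiam_attained (G : tgraph) star :
  @optimal_paths G star !=set0 ->
  exists2 p : seq (appearance G),
    optimal_paths star p & tlength p = tdiam G star.
Proof.
move=> [p Up]; have [s [z [_ /optimal_tpath/tlength_lifetime le_p]]] := Up.
have [|n /asboolP[q Uq qn] Dn] := @eq_bigmax_cond 'I_(lifetime G).+1
  [pred n : 'I__ | `[< exists2 p, @optimal_paths G star p & tlength p = n >]]
  (@nat_of_ord _).
  apply/card_gt0P; exists (Ordinal (le_p : tlength p < _.+1)).
  by apply/asboolP; exists p.
by exists q; rewrite // qn -Dn.
Qed.

Local Open Scope ring_scope.

Record range_space (X : Type) := RangeSpace {
  points : set X;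
  ranges : set (set X) }.

Definition shatters (X : choiceType) (F : set (set X)) (S : {fset X}) : Prop :=
  [set [set` S] `&` A | A in F] = [set B | B `<=` [set` S]].

(* An extended real, so that it is +oo if shattered sets are arbitrarily
   large. *)
Definition VC (R : realType) (X : choiceType) (RS : range_space X) : \bar R :=
  ereal_sup [set (#|` S |%:R)%:E | S in
    [set S : {fset X} | [set` S] `<=` points RS /\ shatters (ranges RS) S]].

Section RangeSpace.
Variables (R : realType) (G : tgraph) (star : criterion).

Definition domain : set (seq (appearance G) * R) :=
  optimal_paths star `*` [set a | 0 <= a <= 1].

Definition f_app (x : appearance G) (p : seq (appearance G)) : R :=
  (x \in Int p)%:R.

Definition R_app (x : appearance G) : set (seq (appearance G) * R) :=
  [set y | domain y /\ y.2 <= f_app x y.1].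

Definition Fplus : set (set (seq (appearance G) * R)) :=
  [set R_app x | x in [set x : appearance G | (1 <= x.2 <= lifetime G)%N]].

Definition tp_range_space : range_space (seq (appearance G) * R)%type :=
  RangeSpace domain Fplus.

End RangeSpace.

Definition log2 (R : realType) (x : R) : R := ln x / ln 2.

(* Main.v *)
(** Let S be shattered and y = (p, a) in S. Some range misses y, so a > 0, and
    hence a range R_x contains y only if x lies in Int p. Each of the
    2 ^ (|S| - 1) subsets of S containing y is cut out by such an x, so
    2 ^ (|S| - 1) <= |Int p| <= VD - 2. *)

Require Import Defs.
From HB Require Import structures.
From mathcomp Require Import all_boot all_order all_algebra finmap.
From mathcomp Require Import all_classical all_reals all_analysis.

Import Order.TTheory GRing.Theory Num.Theory.

Local Open Scope ring_scope.

(** Turns an equality of set families into a membership test, restricted to points of [S] because a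
    trace does not determine [A] elsewhere. *)
Lemma shatters_trace {X : choiceType} {F : set (set X)} {S B : {fset X}} :
  shatters F S -> (B `<=` S)%fset ->
  exists2 A, F A & forall z, z \in S -> (z \in B) = `[< A z >].
Proof.
move=> FS /fsubsetP BS.
have : [set C | (C `<=` [set` S])%classic]%classic [set` B]%classic by [].
rewrite -FS => -[A FA eqB]; exists A => // z zS.
apply/idP/asboolP => [zB | Az].
  have : [set` B]%classic z by [].
  by rewrite -eqB => -[].
by have : [set` B]%classic z by rewrite -eqB.
Qed.

Lemma size_Int {G : tgraph} (p : seq (appearance G)) :
  size (Int p) = (tlength p).-1.
Proof. by case: p => //= x q; rewrite size_behead size_belast. Qed.

Section ShatteredSet.
Context {R : realType} {G : tgraph} {star : criterion}.
Context {S : {fset seq (appearance G) * R}}.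
Hypothesis shS : shatters (Fplus star) S.

Lemma shattered_R_app_Int {y x} : domain star y -> y \in S ->
  R_app star x y -> x \in Int y.1.
Proof.
move=> Dy yS [_]; rewrite /f_app; case: (boolP (x \in _)) => //= _ y_le0.
(* The range with empty trace must miss [y], but a height at most 0 would put [y] in every range. *)
have [A [x' _ <-]] := shatters_trace shS (fsub0set S).
move=> /(_ y yS); rewrite in_fset0 => /esym/asboolP[].
by split=> //; apply: le_trans y_le0 _; rewrite ler0n.
Qed.

Lemma shattered_card {y} : domain star y -> y \in S ->
  (2 ^ (#|` S|).-1 <= size (Int y.1))%N.
Proof.
move=> Dy yS.
(* The trace of the range of [x] on [S] without [y]; every subset of [S] without [y] will be a value
   of [g] on [Int y.1]. *)
pose g x := [fset z in S | `[< R_app star x z >] & z != y]%fset.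
rewrite (cardfsD1 y) yS add1n /= -card_fpowerset -(size_map g).
apply: uniq_leq_size; first exact: fset_uniq.
move=> B; rewrite fpowersetE => /fsubsetP BSy.
(* Adding [y] to [B] makes the range that cuts it out contain [y], which forces its appearance into
   [Int y.1]. *)
have yBS : (y |` B `<=` S)%fset.
  apply/fsubsetP => z /fset1UP[->//|/BSy].
  by rewrite in_fsetD1 => /andP[].
have [A [x _ <-] trB] := shatters_trace shS yBS.
apply/mapP; exists x.
  apply: (shattered_R_app_Int Dy yS).
  by apply/asboolP; rewrite -trB // fset1U1.
apply/fsetP => z; rewrite !inE /=.
have [zS|zS] := boolP (z \in S); last first.
  by apply/negbTE/negP => /BSy; rewrite !inE (negPf zS) andbF.
rewrite -trB // !inE; have [->|_] /= := eqVneq z y; last by rewrite andbT.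
by apply/negbTE/negP => /BSy; rewrite !inE eqxx.
Qed.

End ShatteredSet.

Lemma le_floor_log2 (R : realType) {k n : nat} :
  (2 ^ k <= n)%N -> k%:Z <= Num.floor (log2 (n%:R : R)).
Proof.
move=> kn; rewrite floor_ge_int /log2 -pmulrn.
have ln2_gt0 : 0 < ln 2 :> R by rewrite ln_gt0 // ltr1n.
(* Clearing the denominator [ln 2] leaves [ln (2 ^ k) <= ln n]. *)
rewrite ler_pdivlMr // mulr_natl -lnXn // ler_ln.
- by rewrite -natrX ler_nat.
- by rewrite posrE exprn_gt0.
- by rewrite posrE ltr0n (leq_trans _ kn) // expn_gt0.
Qed.

Theorem lemma2 (R : realType) (G : tgraph) (star : criterion)
    (hVD : (3 <= vdiam G star)%N) :
  (VC R (tp_range_space R G star)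
    <= (Num.floor (log2 ((vdiam G star)%:R - 2 : R)) + 1)%:~R%:E)%E.
Proof.
rewrite -natrB; last exact: ltnW.
apply: ge_ereal_sup => _ [S [/= SD shS] <-].
rewrite lee_fin pmulrn ler_int.
have card_le k : (2 ^ k <= vdiam G star - 2)%N ->
    k.+1%:Z <= Num.floor (log2 ((vdiam G star - 2)%:R : R)) + 1.
  by move=> /(le_floor_log2 R) le_k; rewrite intS [leRHS]addrC lerD2l.
(* For empty [S] the bound only has to be nonnegative: [k = 0] applies since [hVD] gives
   [1 <= vdiam G star - 2]. *)
have [->|[y yS]] := fset_0Vmem S.
  rewrite cardfs0; apply: le_trans (card_le 0 _) => //.
  by rewrite expn0 subn_gt0.
have Dy := SD y yS.
have cS : (0 < #|` S|)%N by rewrite cardfs_gt0; apply/fset0Pn; exists y.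
rewrite -(prednK cS); apply: card_le.
apply: leq_trans (shattered_card shS Dy yS) _.
(* Both sides lose one: the interior has length minus 1 appearances, and [VD - 2 = D - 1]. *)
rewrite size_Int /vdiam subSS -subn1; apply: leq_sub2r.
by apply: tdiam_ub; case: Dy.
Qed.
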